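(* Let $\mathcal{C}\subseteq\mathbb{N}^d$ be a positive integer cone, $\preceq$ a term order on $\mathbb{N}^d$, $k\in\mathcal{C}$, and let $T\in\operatorname{EI}(k)$. Then the set of children of $T$ equals the set of $\mathcal{C}$-semigroups $T\cup\{x\}$ such that $x\in\operatorname{SG}(T)$, $x\notin\operatorname{M}(T)\cup\operatorname{Maximals}_{\leq_{\mathcal{C}}}(\mathcal{H}(T))$, and ($x\succ\frac{k}{2}$ or $3x=k$ or $4x=k$).
   Context: For a finite $A\subseteq\mathbb{N}^d$, the positive integer cone spanned by $A$ is $\mathcal{C}=\{\sum q_ia_i: a_i\in A, q_i\in\mathbb{Q}_{\geq0}\}\cap\mathbb{N}^d$. A $\mathcal{C}$-semigroup is a finitely generated submonoid $S\subseteq\mathcal{C}$ of $(\mathbb{N}^d,+)$ with $\mathcal{C}\setminus S$ finite; $\mathcal{H}(S)=\mathcal{C}\setminus S$; $\operatorname{msg}(S)$ is its (unique) minimal system of generators. $x\leq_{\mathcal{C}}y$ iff $y-x\in\mathcal{C}$; $\operatorname{Maximals}_{\leq_{\mathcal{C}}}$, $\operatorname{Minimals}_{\leq_{\mathcal{C}}}$ denote maximal/minimal elements for this order. $\operatorname{I}_{\mathcal{C}}(k)=\{x\in\mathcal{C}: x\leq_{\mathcal{C}}k\}$. $S$ is $k$-positioned if $k-h\in S$ for all $h\in\mathcal{H}(S)$. $\operatorname{C}(S)=\{x\in\mathcal{C}: x\leq_{\mathcal{C}}h \text{ for some } h\in\mathcal{H}(S)\}$, $\operatorname{M}(S)=\{h\in\mathcal{H}(S):\{s\in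 S: h-s\in S\}=\{0\}\}\cup\{0\}$. $S$ is primary positioned for $k$ if it is $k$-positioned and $|\operatorname{M}(S)|+|\operatorname{C}(S)|=|\operatorname{I}_{\mathcal{C}}(k)|$; $\mathcal{P}(k)$ is the set of such $\mathcal{C}$-semigroups. A term order is a total order $\preceq$ on $\mathbb{N}^d$ with $0\preceq v$ and $u\preceq v\Rightarrow u+w\preceq v+w$. $\operatorname{F}_\preceq(S)=\max_\preceq\mathcal{H}(S)$; $\operatorname{PF}(S)=\{x\in\mathcal{H}(S): x+(S\setminus\{0\})\subseteq S\}$; $\operatorname{SG}(S)=\{x\in\operatorname{PF}(S): 2x\in S\}$. $S$ is symmetric if $\operatorname{PF}(S)=\{\operatorname{F}_\preceq(S)\}$, pseudo-symmetric if $\operatorname{PF}(S)=\{\operatorname{F}_\preceq(S),\operatorname{F}_\preceq(S)/2\}$, irreducible if one of these holds (then the Frobenius element $\operatorname{F}(S)$ is independent of $\preceq$). $\operatorname{EI}(k)=\{S\in\mathcal{P}(k): S=T'\cup\{k\}\text{ or }S=T'\cup\{\frac{k}{2},k\}\text{ for some irreducible }\mathcal{C}\text{-semigroup }T'\text{ with }\operatorname{F}(T')=k\}$. For a $\mathcal{C}$-semigroup $S$, $\operatorname{B}(S)=\{x\in\operatorname{msg}(S): x\in\operatorname{C}(S)\setminus\operatorname{Minimals}_{\leq_{\mathcal{C}}}(S\setminus\{0\}),\ k-x\in S,\ x\neq\frac{k}{2}\}$, and when $\operatorname{B}(S)\neq\emptyset$, $\beta(S)=\max_\preceq\operatorname{B}(S)$.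 (The paper shows $\operatorname{B}(S)\ne\emptyset$ and $S\setminus\{\beta(S)\}\in\mathcal{P}(k)$ for $S\in\mathcal{P}(k)\setminus\operatorname{EI}(k)$.) The map $\Psi_k:\mathcal{P}(k)\setminus\operatorname{EI}(k)\to\mathcal{P}(k)$ is $\Psi_k(S)=S\setminus\{\beta(S)\}$. For $S_1\in\mathcal{P}(k)\setminus\operatorname{EI}(k)$ and $S_2\in\mathcal{P}(k)$, $S_1$ is a child of $S_2$ iff $\Psi_k(S_1)=S_2$.
   Formalization: M(S) is taken with h−s in the cone C instead of h−s in S: as printed, no gap h can satisfy the condition, so M(S) would always be {0} and EI(k) would be empty for every k. *)

(* Defs.v *)
From HB Require Import structures.
From mathcomp Require Import all_boot all_order all_algebra.
From mathcomp Require Import finmap.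
From mathcomp Require Import boolp classical_sets functions cardinality.
Set Implicit Arguments.
Unset Strict Implicit.
Unset Printing Implicit Defensive.
Import GRing.Theory.
Local Open Scope classical_set_scope.
Local Open Scope ring_scope.

Notation "'NN^ d" := 'rV[nat]_d (at level 8, d at level 2, format "''NN^' d").

Definition toQ (d : nat) (x : 'NN^d) : 'rV[rat]_d := map_mx (fun n : nat => n%:R) x.

Definition cone (d : nat) (A : {fset 'NN^d}) : set 'NN^d :=
  [set x | exists2 q : 'NN^d -> rat,
     (forall a, 0 <= q a) & toQ x = \sum_(a <- A) q a *: toQ a].

(* [diff_in S x y] is the assertion "x - y \in S": the difference is taken in
   Z^d, and S is a subset of N^d. *)
Definition diff_in (d : nat) (S : set 'NN^d) (x y : 'NN^d) : Prop :=
  exists2 s, S s & x = y + s.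

Definition leC (d : nat) (A : {fset 'NN^d}) (x y : 'NN^d) : Prop :=
  diff_in (cone A) y x.

Definition maximals (d : nat) (R : 'NN^d -> 'NN^d -> Prop) (X : set 'NN^d) : set 'NN^d :=
  [set x | X x /\ forall y, X y -> R x y -> y = x].

Definition minimals (d : nat) (R : 'NN^d -> 'NN^d -> Prop) (X : set 'NN^d) : set 'NN^d :=
  [set x | X x /\ forall y, X y -> R y x -> y = x].

Definition IC (d : nat) (A : {fset 'NN^d}) (k : 'NN^d) : set 'NN^d :=
  [set x | cone A x /\ leC A x k].

Definition submonoid (d : nat) (S : set 'NN^d) : Prop :=
  S 0 /\ forall x y, S x -> S y -> S (x + y).

Definition generated (d : nat) (X : set 'NN^d) : set 'NN^d :=
  [set x | exists2 s : seq 'NN^d, (forall a, a \in s -> X a) & x = \sum_(a <- s) a].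

Definition finitely_generated (d : nat) (S : set 'NN^d) : Prop :=
  exists2 X : set 'NN^d, finite_set X & generated X = S.

Definition gaps (d : nat) (A : {fset 'NN^d}) (S : set 'NN^d) : set 'NN^d :=
  cone A `\` S.

Definition c_semigroup (d : nat) (A : {fset 'NN^d}) (S : set 'NN^d) : Prop :=
  [/\ submonoid S, S `<=` cone A, finitely_generated S & finite_set (gaps A S)].

Definition minimal_system (d : nat) (S X : set 'NN^d) : Prop :=
  generated X = S /\
  forall Y : set 'NN^d, Y `<=` X -> generated Y = S -> Y = X.

(* A submonoid of N^d has exactly one minimal system of generators. *)
Definition msg (d : nat) (S : set 'NN^d) : set 'NN^d :=
  xget set0 [set X | minimal_system S X].

Definition PF (d : nat) (A : {fset 'NN^d}) (S : set 'NN^d) : set 'NN^d :=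
  [set x | gaps A S x /\ forall s, (S `\ 0) s -> S (x + s)].

Definition SG (d : nat) (A : {fset 'NN^d}) (S : set 'NN^d) : set 'NN^d :=
  [set x | PF A S x /\ S (x *+ 2)].

Definition positioned (d : nat) (A : {fset 'NN^d}) (k : 'NN^d) (S : set 'NN^d) : Prop :=
  forall h, gaps A S h -> diff_in S k h.

Definition below_gaps (d : nat) (A : {fset 'NN^d}) (S : set 'NN^d) : set 'NN^d :=
  [set x | cone A x /\ exists2 h, gaps A S h & leC A x h].

(* The gaps h such that 0 is the only s \in S with s <=_C h, together with 0.
   The condition on s has to be h - s \in C, not h - s \in S: for a gap h there
   is no s \in S at all with h - s \in S. *)
Definition MM (d : nat) (A : {fset 'NN^d}) (S : set 'NN^d) : set 'NN^d :=
  [set h | gaps A S h /\ [set s | S s /\ diff_in (cone A) h s] = [set 0]] `|` [set 0].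

(* [fset_set] is meaningful on finite sets only; the three sets below are finite
   whenever S is a C-semigroup. *)
Definition primary (d : nat) (A : {fset 'NN^d}) (k : 'NN^d) (S : set 'NN^d) : Prop :=
  [/\ c_semigroup A S, positioned A k S &
      (#|` fset_set (MM A S)| + #|` fset_set (below_gaps A S)|
         = #|` fset_set (IC A k)|)%N].

Definition term_order (d : nat) (le : rel 'NN^d) : Prop :=
  [/\ reflexive le, antisymmetric le, transitive le & total le] /\
  ((forall v, le 0 v) /\ (forall u v w, le u v -> le (u + w) (v + w))).

Definition strict (d : nat) (le : rel 'NN^d) (u v : 'NN^d) : bool :=
  (u != v) && le u v.

(* Maximum of X for a total order, with value 0 when there is none. *)
Definition max_le (d : nat) (le : rel 'NN^d) (X : set 'NN^d) : 'NN^d :=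
  xget 0 [set x | X x /\ forall y, X y -> le y x].

Definition frob (d : nat) (A : {fset 'NN^d}) (le : rel 'NN^d) (S : set 'NN^d) : 'NN^d :=
  max_le le (gaps A S).

Definition symmetric_sg (d : nat) (A : {fset 'NN^d}) (le : rel 'NN^d) (S : set 'NN^d) : Prop :=
  PF A S = [set frob A le S].

Definition pseudo_symmetric_sg (d : nat) (A : {fset 'NN^d}) (le : rel 'NN^d)
    (S : set 'NN^d) : Prop :=
  exists2 f, f *+ 2 = frob A le S & PF A S = [set frob A le S; f].

Definition irreducible_sg (d : nat) (A : {fset 'NN^d}) (le : rel 'NN^d) (S : set 'NN^d) : Prop :=
  symmetric_sg A le S \/ pseudo_symmetric_sg A le S.

Definition EI (d : nat) (A : {fset 'NN^d}) (le : rel 'NN^d) (k : 'NN^d) : set (set 'NN^d) :=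
  [set S | primary A k S /\
    exists T', [/\ c_semigroup A T', irreducible_sg A le T', frob A le T' = k &
      S = T' `|` [set k] \/
      exists2 h, h *+ 2 = k & S = T' `|` [set h; k]]].

Definition BB (d : nat) (A : {fset 'NN^d}) (k : 'NN^d) (S : set 'NN^d) : set 'NN^d :=
  [set x | [/\ msg S x,
               (below_gaps A S `\` minimals (leC A) (S `\ 0)) x,
               diff_in S k x & x *+ 2 <> k]].

Definition beta (d : nat) (A : {fset 'NN^d}) (le : rel 'NN^d) (k : 'NN^d)
    (S : set 'NN^d) : 'NN^d :=
  max_le le (BB A k S).

Definition Psi (d : nat) (A : {fset 'NN^d}) (le : rel 'NN^d) (k : 'NN^d)
    (S : set 'NN^d) : set 'NN^d :=
  S `\ beta A le k S.

Definition child (d : nat) (A : {fset 'NN^d}) (le : rel 'NN^d) (k : 'NN^d)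
    (S1 S2 : set 'NN^d) : Prop :=
  [/\ primary A k S1, ~ EI A le k S1, primary A k S2 & Psi A le k S1 = S2].

(* "x is greater than k/2", where k/2 need not be integral: a term order extends
   uniquely to the nonnegative rational vectors by clearing denominators. *)
Definition gt_half (d : nat) (le : rel 'NN^d) (x k : 'NN^d) : bool :=
  strict le k (x *+ 2).

(* Main.v *)
(** Write [S = T `|` [set x]] with [x] a gap of [T].  An element of [EI] contains
    [k], and [k] is a sum of two of its nonzero elements only as [k/2 + k/2].
    Since [x] is neither minimal nor maximal in the relevant sense, [T] and [S]
    have the same [M] and the same [C], so that the cardinality condition
    transfers.  In [S] the only new decomposition of [k] is [x + (k - x)], so the
    only competitor of [x] for [beta S] is [k - x]; it is smaller than [x] when
    [x > k/2], and otherwise it has to be decomposable in [S], which forces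
    [3x = k] or [4x = k]. *)
Require Import Defs.
From HB Require Import structures.
From mathcomp Require Import all_boot all_order all_algebra.
From mathcomp Require Import finmap.
From mathcomp Require Import boolp classical_sets functions cardinality.
Set Implicit Arguments.
Unset Strict Implicit.
Unset Printing Implicit Defensive.
Import GRing.Theory.
Local Open Scope classical_set_scope.
Local Open Scope ring_scope.

(** * Cancellation, positivity and total degree in ['NN^d] *)

Lemma addvI (d : nat) (x : 'NN^d) : injective (+%R x).
Proof.
move=> y z /matrixP e; apply/matrixP => i j.
by have := e i j; rewrite !mxE => /addnI.
Qed.

Lemma addv_eq0 (d : nat) (x y : 'NN^d) : x + y = 0 -> x = 0 /\ y = 0.
Proof.
move=> /matrixP e.
by split; apply/matrixP => i j; have /eqP := e i j; rewrite !mxE addn_eq0;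
  case/andP => /eqP ? /eqP ?.
Qed.

Lemma addv_eql (d : nat) (x y : 'NN^d) : x + y = x -> y = 0.
Proof. by rewrite -[RHS in _ = RHS]addr0 => /addvI. Qed.

(** Induction measure: it is additive and positive off 0, so both terms of a sum of nonzero vectors
    weigh less than the sum. *)
Definition weight (d : nat) (x : 'NN^d) : nat := (\sum_i x ord0 i)%N.

Lemma weightD (d : nat) (x y : 'NN^d) : weight (x + y) = (weight x + weight y)%N.
Proof. by rewrite -big_split; apply: eq_bigr => i _; rewrite mxE. Qed.

Lemma weight_gt0 (d : nat) (x : 'NN^d) : x <> 0 -> (0 < weight x)%N.
Proof.
move=> x0; rewrite lt0n; apply/eqP => /eqP; rewrite sum_nat_eq0 => /forallP w0.
by apply: x0; apply/matrixP => i j; rewrite mxE ord1; apply/eqP/w0.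
Qed.

(** * The order induced by the cone *)

Section Cone.
Variables (d : nat) (A : {fset 'NN^d}).
Implicit Types x y z : 'NN^d.

Lemma cone0 : cone A 0.
Proof.
exists (fun=> 0) => //; rewrite big1 => [|a _]; last by rewrite scale0r.
by apply/matrixP => i j; rewrite !mxE.
Qed.

Lemma coneD x y : cone A x -> cone A y -> cone A (x + y).
Proof.
move=> [p p0 xE] [q q0 yE]; exists (fun a => p a + q a).
  by move=> a; apply: Num.Theory.addr_ge0.
under eq_bigr do rewrite scalerDl.
rewrite big_split -xE -yE.
by apply/matrixP => i j; rewrite !mxE natrD.
Qed.

Lemma leC_trans y x z : leC A x y -> leC A y z -> leC A x z.
Proof.
by move=> [s Cs ->] [t Ct ->]; exists (s + t); [exact: coneD | rewrite addrA].
Qed.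

(** Complements in a common sum reverse the order. With the sum equal to [k], a larger gap has a
    smaller complement. *)
Lemma leC_subl x y u v : x + u = y + v -> leC A x y -> leC A v u.
Proof.
by move=> e [s Cs yE]; exists s => //; apply: (@addvI _ x); rewrite e yE addrAC addrA.
Qed.

End Cone.

(** * Cancellation and maxima for a term order *)

Section TermOrder.
Variables (d : nat) (le : rel 'NN^d).
Hypothesis hle : term_order le.
Implicit Types x y z : 'NN^d.

Lemma le_addr x y : le x (x + y).
Proof. by case: hle => _ [p0 pD]; rewrite -{1}[x]add0r [x + y]addrC; apply: pD. Qed.

Lemma strict_le x y z : strict le (x + z) (y + z) -> le x y.
Proof.
case: hle => [[r a t tot] [p0 pD]] /andP[ne xy].
case/orP: (tot x y) => // /pD -/(_ z) yx.
by case/eqP: ne; apply: a; rewrite xy yx.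
Qed.

Lemma max_le_eq (X : set 'NN^d) x : X x -> (forall y, X y -> le y x) -> max_le le X = x.
Proof.
case: hle => [[_ a _ _] _] Xx xmax; apply: xget_unique => //.
by move=> y [Xy ymax]; apply: a; rewrite xmax ?ymax.
Qed.

End TermOrder.

(** * Indecomposable elements as the minimal system of generators *)

Definition atoms (d : nat) (S : set 'NN^d) : set 'NN^d :=
  [set x | [/\ S x, x <> 0 &
    forall a b, S a -> S b -> x = a + b -> a = 0 \/ b = 0]].

Section Atoms.
Variables (d : nat) (S : set 'NN^d).
Hypothesis hS : submonoid S.

Lemma not_atom x : S x -> x <> 0 -> ~ atoms S x ->
  exists a b, [/\ S a, S b, a <> 0, b <> 0 & x = a + b].
Proof.
move=> Sx x0 nx; apply: contrapT => nab; apply: nx; split=> // a b Sa Sb xE.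
apply: contrapT => /not_orP[a0 b0]; apply: nab.
by exists a, b.
Qed.

Lemma generated_atoms : generated (atoms S) = S.
Proof.
case: hS => S0 SD; apply/seteqP; split=> x.
  move=> [s sS ->]; rewrite big_seq; elim/big_ind: _ => // a /sS.
  by case.
move=> Sx; have [n] := ubnP (weight x); elim: n x Sx => // n IH x Sx xn.
have [->|x0] := pselect (x = 0); first by exists [::]; rewrite ?big_nil.
have [ax|] := pselect (atoms S x).
  by exists [:: x]; rewrite ?big_seq1 // => a; rewrite inE => /eqP ->.
case/(not_atom Sx x0) => a [b [Sa Sb a0 b0 xE]].
move: xn; rewrite xE weightD ltnS => xn.
have [|s sS ->] := IH a Sa.
  by rewrite (leq_trans _ xn) // -{1}[weight a]addn0 ltn_add2l weight_gt0.
have [|t tS ->] := IH b Sb.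
  by rewrite (leq_trans _ xn) // -{1}[weight b]add0n ltn_add2r weight_gt0.
by exists (s ++ t); rewrite ?big_cat // => c; rewrite mem_cat => /orP[/sS|/tS].
Qed.

(** When an atom is written as a sum of generators, either the head or the sum of the tail vanishes.
    Induction on the list then reaches a summand equal to the atom. *)
Lemma atoms_sub_generators X : generated X = S -> atoms S `<=` X.
Proof.
move=> gX x [Sx x0 xirr]; move: (Sx); rewrite -gX => -[s].
elim: s => [|a s IH] sX xE; first by case: x0; rewrite xE big_nil.
have Xa : X a by apply: sX; rewrite mem_head.
have {}sX b : b \in s -> X b by move=> bs; apply: sX; rewrite inE bs orbT.
rewrite big_cons in xE.
have [||a0|b0] := xirr _ _ _ _ xE.
- by rewrite -gX; exists [:: a]; rewrite ?big_seq1 // => c; rewrite inE => /eqP ->.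
- by rewrite -gX; exists s.
- by apply: IH => //; rewrite xE a0 add0r.
- by rewrite xE b0 addr0.
Qed.

Lemma msgE : msg S = atoms S.
Proof.
apply: xget_unique.
  split; first exact: generated_atoms.
  by move=> Y YS /atoms_sub_generators SY; apply/seteqP.
move=> X [gX Xmin]; apply/esym/Xmin; last exact: generated_atoms.
exact: atoms_sub_generators.
Qed.

End Atoms.

(** * Witnesses against extremality, and membership of gaps in M *)

Section Extremal.
Variables (d : nat) (A : {fset 'NN^d}) (S : set 'NN^d).
Implicit Types x : 'NN^d.

Lemma not_minimal x : S x -> x <> 0 -> ~ minimals (leC A) (S `\ 0) x ->
  exists s, [/\ S s, s <> 0, s <> x & leC A s x].
Proof.
move=> Sx x0 nmin; apply: contrapT => nex; apply: nmin; split=> // s [Ss s0] sx.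
by apply: contrapT => sNx; apply: nex; exists s.
Qed.

Lemma not_maximal_gap x : gaps A S x -> ~ maximals (leC A) (gaps A S) x ->
  exists h, [/\ gaps A S h, h <> x & leC A x h].
Proof.
move=> Sx nmax; apply: contrapT => nex; apply: nmax; split=> // h Sh xh.
by apply: contrapT => hNx; apply: nex; exists h.
Qed.

Lemma gap_neq0 x : submonoid S -> gaps A S x -> x <> 0.
Proof. by move=> [S0 _] [_ nSx] x0; apply: nSx; rewrite x0. Qed.

Lemma MM_gapE x : submonoid S -> gaps A S x ->
  MM A S x <-> forall s, S s -> leC A s x -> s = 0.
Proof.
move=> hS gx; have x0 := gap_neq0 hS gx; split.
  by case=> [[_ e] s Ss sx|//]; have : [set s | S s /\ leC A s x] s by []; rewrite e.
move=> small; left; split=> //; apply/seteqP; split=> s; first by case; exact: small.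
move=> ->; split; first by case: hS.
by exists x; [case: gx | rewrite add0r].
Qed.

End Extremal.

(** * Invariance of M and C when a gap is adjoined *)

Section AddGap.
Variables (d : nat) (A : {fset 'NN^d}) (T : set 'NN^d) (x : 'NN^d).
Hypotheses (hT : submonoid T) (gx : gaps A T x).
Hypotheses (nM : ~ MM A T x) (nmax : ~ maximals (leC A) (gaps A T) x).
Hypothesis hS : submonoid (T `|` [set x]).

Lemma gaps_setU1 h : gaps A (T `|` [set x]) h <-> gaps A T h /\ h <> x.
Proof.
split=> [[Ch /not_orP[nT nx]] //|[[Ch nT] nx]].
by split=> // -[].
Qed.

(** Only [x] stops being a gap, and whatever lies below [x] also lies below a larger gap, which
    exists because [x] is not maximal. *)
Lemma below_gaps_setU1 : below_gaps A (T `|` [set x]) = below_gaps A T.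
Proof.
apply/seteqP; split=> y [Cy [h gh yh]]; split=> //.
  by exists h => //; case/gaps_setU1: gh.
have [hx|hx] := pselect (h = x); last by exists h => //; apply/gaps_setU1.
have [h' [gh' h'x xh']] := not_maximal_gap gx nmax.
exists h'; first exact/gaps_setU1.
by apply: leC_trans xh'; rewrite -hx.
Qed.

Lemma below_notM : exists t, [/\ T t, t <> 0 & leC A t x].
Proof.
apply: contrapT => nex; apply: nM; apply/MM_gapE => // s Ts sx.
by apply: contrapT => s0; apply: nex; exists s.
Qed.

(** The new element [x] could only expel from M a gap above [x]. Such a gap already lies above a
    nonzero element of [T] that is below [x], so it was not in M before. *)
Lemma MM_setU1 : MM A (T `|` [set x]) = MM A T.
Proof.
apply/seteqP; split=> h Mh; (have [->|h0] := pselect (h = 0); first by right).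
  have gh : gaps A (T `|` [set x]) h by case: Mh => [[]|].
  have [ghT _] := (gaps_setU1 h).1 gh.
  apply/MM_gapE => // s Ts; apply: ((MM_gapE hS gh).1 Mh); by left.
have ghT : gaps A T h by case: Mh => [[]|].
have hx : h <> x by move=> hx; apply: nM; rewrite -hx.
have gh : gaps A (T `|` [set x]) h by apply/gaps_setU1.
have small := (MM_gapE hT ghT).1 Mh.
apply/MM_gapE => // s [|->]; first exact: small.
move=> xh; have [t [Tt t0 tx]] := below_notM.
by case: t0; apply: small => //; apply: leC_trans xh.
Qed.

Lemma primary_setU1 k : c_semigroup A (T `|` [set x]) -> primary A k T ->
  primary A k (T `|` [set x]).
Proof.
move=> cS [_ pos card]; split=> //; last by rewrite MM_setU1 below_gaps_setU1.
by move=> h /gaps_setU1[/pos[s Ts ->] _]; exists s => //; left.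
Qed.

End AddGap.

(** The Frobenius element [k] is a gap of [T'], so two summands from [T'] never give [k]. Some
    summand is therefore [k], which leaves 0 for the other, or [k/2], which makes both equal. *)
Lemma EI_decomposition d (A : {fset 'NN^d}) (le : rel 'NN^d) (k : 'NN^d) (T : set 'NN^d) :
  EI A le k T ->
  T k /\ forall a b, T a -> T b -> a + b = k -> [\/ a = 0, b = 0 | a = b].
Proof.
move=> [_ [T' [[[T'0 T'D] _ _ _] irr fE TE]]].
have T'k : ~ T' k.
  suff : PF A T' k by case=> -[].
  by case: irr => [|[f _]] ->; rewrite fE //; left.
split; first by case: TE => [|[h _]] ->; right; [|right].
have sumk a b : a + b = k -> a = k -> b = 0.
  by move=> e ak; apply: (@addv_eql _ k); rewrite -{1}ak.
move=> a b Ta Tb e.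
have [ak|ak] := pselect (a = k); first by apply: Or32; apply: sumk e ak.
have [bk|bk] := pselect (b = k);
  first by apply: Or31; apply: (sumk b) => //; rewrite addrC.
have T'ab : T' a -> T' b -> False by move=> Ta' Tb'; apply: T'k; rewrite -e; apply: T'D.
case: TE => [TE|[h hk TE]]; rewrite TE in Ta Tb.
  by case: Ta => // Ta; case: Tb => // Tb; case: (T'ab Ta Tb).
have hE a' b' : a' + b' = k -> a' = h -> a' = b'.
  by move=> e' a'h; apply: (@addvI _ a'); rewrite e' a'h -mulr2n hk.
apply: Or33.
case: Ta => [Ta|[ah|//]]; last exact: hE.
case: Tb => [Tb|[bh|//]]; last by apply/esym/hE; rewrite // addrC.
by case: (T'ab Ta Tb).
Qed.

(** * The two inclusions for the children of [T] *)

Section Children.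
Variables (d : nat) (A : {fset 'NN^d}) (le : rel 'NN^d) (k : 'NN^d) (T : set 'NN^d).
Hypotheses (hle : term_order le) (hT : EI A le k T).

Lemma child_addition S : child A le k S T ->
  exists x, [/\ S = T `|` [set x], SG A T x,
    ~ (MM A T `|` maximals (leC A) (gaps A T)) x &
    [\/ gt_half le x k, x *+ 3 = k | x *+ 4 = k]].
Proof.
move=> [[[hS SC _ _] Spos _] _ [[hTm TC _ _] Tpos _] PsiE].
have [Tk Tdec] := EI_decomposition hT.
set x := beta A le k S; have TE : T = S `\ x by rewrite -PsiE.
have [S0 SD] := hS.
(* [max_le] returns 0 when there is no maximum. Here it cannot be 0, since removing 0 from [S] would
   not leave a monoid. *)
have [Bx xmax] : BB A k S x /\ forall y, BB A k S y -> le y x.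
  have : x <> 0 by move=> x0; case: hTm; rewrite TE => -[_]; rewrite x0; case.
  by rewrite /x /beta /max_le; case: xgetP.
have [] := Bx; rewrite msgE // => -[Sx x0 _] [[_ [h gh xh]] xnmin] [k' Sk' kE] x2k.
have [s [Ss s0 sx sLx]] := not_minimal Sx x0 xnmin.
have ST y : S y -> y <> x -> T y by move=> Sy yx; rewrite TE.
have TS y : T y -> S y by rewrite TE => -[].
have nTx : ~ T x by rewrite TE => -[_]; apply.
have gTx : gaps A T x by split=> //; apply: SC.
have hx : h <> x by move=> hx; case: gh => _; rewrite hx.
have gTh : gaps A T h by case: gh => Ch nSh; split=> // /TS.
have STE : S = T `|` [set x].
  apply/seteqP; split=> y; last by case=> [/TS|->].
  by have [->|yx Sy] := pselect (y = x); [right | left; apply: ST].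
have addx y : S y -> y <> 0 -> T (x + y).
  by move=> Sy y0; apply: ST; [apply: SD | move=> /addv_eql].
have nM : ~ MM A T x by move/(MM_gapE hTm gTx)/(_ s (ST _ Ss sx) sLx).
have nmax : ~ maximals (leC A) (gaps A T) x by move=> [_ /(_ h gTh xh)].
have SGx : SG A T x.
  by split; [split=> // y [/TS]; exact: addx | rewrite /= mulr2n; apply: addx].
exists x; split=> //; first by case.
have [gth|/negP ngt] := pselect (gt_half le x k); first exact: Or31.
have lek : le (x *+ 2) k.
  case: hle => [[_ _ _ tot] _]; move: ngt; rewrite /gt_half /strict.
  have -> : k != x *+ 2 by apply/eqP => /esym.
  by case/orP: (tot (x *+ 2) k) => // ->.
have le_anti a b : le a b -> le b a -> a = b.
  by move=> ab ba; case: hle => [[_ an _ _] _]; apply: an; rewrite ab ba.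
have k'x : k' <> x by move=> k'x; apply: x2k; rewrite kE k'x.
have Tk' : T k' by apply: ST.
have k'0 : k' <> 0 by move=> k'0; apply: nTx; move: Tk; rewrite kE k'0 addr0.
have hLx : leC A k' x -> False.
  move=> [t _ xE]; apply: x2k; apply: le_anti => //.
  by rewrite kE mulr2n {3}xE addrA; apply: le_addr.
have xLk' : le x k'.
  by case: hle => [[_ _ _ tot] [_ pD]]; apply: (strict_le hle (z := x));
    rewrite -mulr2n [k' + x]addrC -kE; apply/andP; split=> //; apply/eqP.
(* The complement [k'] is above [x] in the term order, so it must fail some condition of [BB]. All
   of them except indecomposability are verified next. *)
have nB : ~ BB A k S k'.
  move=> /xmax k'Lx; exact/k'x/le_anti.
have Ck' : below_gaps A S k'.
  (* With [x = s + r], one has [k = s + (r + k')]. If [k'] is below no gap, then [r + k'] is in [S],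
     and every admissible decomposition of [k] puts [k'] below [x]. *)
  apply: contrapT => nCk'.
  have [r Cr xE] := sLx.
  have Cs : cone A (r + k') by apply: coneD; [|exact: SC].
  have krE : k = s + (r + k') by rewrite kE xE addrA.
  have Skr : S (r + k').
    apply: contrapT => nS; apply: nCk'; split; first exact: SC.
    by exists (r + k') => //; exists r; rewrite // addrC.
  have [rx|rx] := pselect (r + k' = x).
    by apply: hLx; exists r; rewrite // -rx addrC.
  have [//|/addv_eq0[_ //]|sE] := Tdec _ _ (ST _ Ss sx) (ST _ Skr rx) (esym krE).
  by apply: hLx; exists (r + r); [exact: coneD | rewrite xE sE [r + k']addrC addrA].
have nmin : ~ minimals (leC A) (S `\ 0) k'.
  (* The complement [g] of the gap [h] above [x] is nonzero and lies below [k']. Minimality would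
     give [g = k'], hence [h = x]. *)
  move=> [_ min]; have [g Tg kEg] := Tpos _ gTh.
  have gk' : leC A g k' by apply: leC_subl xh; rewrite -kE -kEg.
  have g0 : g <> 0.
    by move=> g0; case: gTh => _; apply; move: Tk; rewrite kEg g0 addr0.
  have gE : g = k' by apply: min => //; split=> //; apply: TS.
  apply: hx; apply: (@addvI _ g).
  by rewrite addrC -kEg kE gE addrC.
have k'2 : k' *+ 2 <> k.
  by rewrite kE mulr2n addrC => /addvI.
have [] := not_atom Sk' k'0.
  move=> ak'; apply: nB; split=> //; first by rewrite msgE.
  by exists x; rewrite // addrC.
move=> a [b [Sa Sb a0 b0 k'E]].
(* Regroup [k = x + c + c'] as [c + (x + c')], with both terms in [T]. *)
have k'sum c c' : S c -> S c' -> c <> 0 -> c' <> 0 -> c <> x -> k' = c + c' -> c = x + c'.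
  move=> Sc Sc' c0 c'0 cx cE.
  have [|//|/addv_eq0[] //|//] := Tdec c (x + c') (ST _ Sc cx) (addx _ Sc' c'0).
  by rewrite kE cE addrCA.
(* Here [k = 2x + c]. Either [c = x], or both [2x] and [c] are in [T] and must coincide. *)
have k'xsum c : S c -> c <> 0 -> k' = x + c ->
    [\/ gt_half le x k, x *+ 3 = k | x *+ 4 = k].
  move=> Sc c0 cE; have [cx|cx] := pselect (c = x).
    by apply: Or32; rewrite kE cE cx !mulrS addr0.
  have [|/addv_eq0[] //|//|xxc] := Tdec (x + x) c (addx _ Sx x0) (ST _ Sc cx).
    by rewrite kE cE addrA.
  by apply: Or33; rewrite kE cE -xxc !mulrS addr0.
have [ax|ax] := pselect (a = x); first by apply: (k'xsum b); rewrite // -ax.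
have [bx|bx] := pselect (b = x); first by apply: (k'xsum a); rewrite // -bx addrC.
have aE := k'sum _ _ Sa Sb a0 b0 ax k'E.
have bE : b = x + a by apply: k'sum; rewrite // addrC.
(* If neither summand is [x], then [a = x + b] and [b = x + a], which forces [2x = 0]. *)
have /addv_eql/addv_eq0[] // : a + (x + x) = a.
by rewrite {2}aE bE addrC addrA.
Qed.

Lemma addition_child x : c_semigroup A (T `|` [set x]) -> SG A T x ->
  ~ (MM A T `|` maximals (leC A) (gaps A T)) x ->
  [\/ gt_half le x k, x *+ 3 = k | x *+ 4 = k] ->
  child A le k (T `|` [set x]) T.
Proof.
move=> cS [[gx _] Sxx] /not_orP[nM nmax] xk.
have [Tk Tdec] := EI_decomposition hT.
have [pT _] := hT; have [[hTm TC _ _] Tpos _] := pT.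
have [hS _ _ _] := cS; have x0 := gap_neq0 hTm gx.
have nTx : ~ T x by case: gx.
have pS := primary_setU1 hTm gx nM nmax hS cS pT.
have [k' Tk' kE] := Tpos _ gx.
have Sx : (T `|` [set x]) x by right.
have k'0 : k' <> 0 by move=> k'0; apply: nTx; move: Tk; rewrite kE k'0 addr0.
have k'x : x <> k' by move=> k'x; apply: nTx; rewrite k'x.
have x2k : x *+ 2 <> k by rewrite kE mulr2n => /addvI.
have [h [gh hx xh]] := not_maximal_gap gx nmax.
have ghS : gaps A (T `|` [set x]) h by apply/gaps_setU1.
have [t [Tt t0 tx]] := below_notM hTm gx nM.
have Bx : BB A k (T `|` [set x]) x.
  split=> //; first last.
  - by exists k'; first by left.
  - split; first by case: gx => Cx _; split=> //; exists h.
    by case=> _ /(_ t) tmin; apply: nTx; rewrite -tmin //; split=> //; left.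
  (* Since [x] is not in [T], one summand must be [x] itself, and the other is then 0. *)
  rewrite msgE //; split=> // a b [Ta|->] [Tb|->] xE.
  - by case: nTx; rewrite xE; case: hTm => _; apply.
  - by left; apply: (@addv_eql _ x); rewrite addrC -xE.
  - by right; apply: (@addv_eql _ x); rewrite -xE.
  - by left; apply: (@addv_eql _ x).
have bE : beta A le k (T `|` [set x]) = x.
  apply: max_le_eq => // y; rewrite /BB /= msgE //.
  move=> [[Sy y0 yirr] [[_ [g [Cg nSg] yg]] _] [y' Sy' ykE] y2k].
  have le_refl : le x x by case: hle => [[]].
  case: Sy => [Ty|->//]; case: Sy' => [Ty'|y'x].
    have [//||yy'] := Tdec _ _ Ty Ty' (esym ykE).
      (* In this case [y = k] lies below the gap [g]. As [k - g] is in [T], this forces [g = k], an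
         element of [T]. *)
      move=> y'0; move: ykE; rewrite y'0 addr0 => ky.
      have [|f Tf kgf] := Tpos g; first by split=> // Tg; apply: nSg; left.
      case: yg => r _; rewrite -ky kgf -addrA => /esym/addv_eql/addv_eq0[f0 _].
      by case: nSg; left; move: Tk; rewrite kgf f0 addr0.
    by case: y2k; rewrite ykE -yy' mulr2n.
  have yE : y = k' by apply: (@addvI _ x); rewrite -kE ykE y'x addrC.
  (* The competitor is now [k' = k - x]. It is at most [x] in the first case, and decomposes as
     [x + x] or [x + 2x] in the others, where [2x] is in [T] because [x] is in [SG A T]. *)
  case: xk => [xk|x3|x4].
  - apply: (strict_le hle (z := x)).
    by rewrite -mulr2n yE addrC -kE.
  - have [|//|//] := yirr x x Sx Sx.
    by rewrite yE; apply: (@addvI _ x); rewrite -kE -x3 !mulrS addr0.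
  - have [||/x0[] //|/addv_eq0[/x0[]]] := yirr x (x + x) Sx.
    + by left; rewrite mulr2n in Sxx.
    + by rewrite yE; apply: (@addvI _ x); rewrite -kE -x4 !mulrS addr0.
split=> //.
  (* The sum [k = x + k'] has distinct nonzero terms in [S], which excludes [S] from [EI]. *)
  move=> /EI_decomposition[_ Sdec].
  by have [] := Sdec x k' Sx (or_introl Tk') (esym kE).
rewrite /Psi bE; apply/seteqP; split=> y; first by case=> [[]].
by move=> Ty; split; [left | move=> yx; apply: nTx; rewrite -yx].
Qed.

End Children.

Theorem theorem5p9 (d : nat) (A : {fset 'NN^d}) (le : rel 'NN^d)
    (hle : term_order le) (k : 'NN^d) (hk : cone A k)
    (T : set 'NN^d) (hT : EI A le k T) :
  [set S | child A le k S T] =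
  [set S | c_semigroup A S /\
     exists x : 'NN^d,
       [/\ S = T `|` [set x],
           SG A T x,
           ~ (MM A T `|` maximals (leC A) (gaps A T)) x &
           [\/ gt_half le x k, x *+ 3 = k | x *+ 4 = k]]].
Proof.
apply/seteqP; split=> S /=.
  move=> ST; split; last exact: child_addition.
  by case: ST => [[]].
by move=> [cS [x [SE xSG nx xk]]]; rewrite SE in cS *; apply: addition_child.
Qed.
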